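(* Let $d=2$ (with $b=0$), or $d=3$ with $L_2+L_3=0$. Assume that the stabilizing parameter $\kappa$ satisfies $$\kappa\ge\max\Big\{a+c\big(\eta^{(d)}\big)^2,\ \max_{\xi\in[0,\eta^{(d)}]}|\overline f'(\xi)|\Big\}$$ and that the time step $\tau>0$ satisfies $$\tau\le\Big(\frac{\kappa G^*}{2}+\frac{2^{d-1}L}{h^2}\Big)^{-1}.$$ Then the MBP-sESAV2 scheme preserves the maximum bound principle: the sequence $(Q_h^n,s^n)_{n\ge0}$ it generates satisfies $$\|Q_h^n\|_{F,\infty}\le\eta^{(d)}\qquad\text{for all } n\ge0 .$$
   Context: Parameters: $a\in\mathbb R$, $b\ge0$, $c>0$, with $b=0$ if $d=2$; $L_1,L_2,L_3$ are the elastic constants and $L=L_1+\frac{L_2+L_3}{2}>0$ (so $L=L_1$ in the case $d=3$, $L_2+L_3=0$). Domain $\Omega=[0,L_d]^d$, mesh size $h=L_d/M$ with $M$ a positive integer, uniform grid with nodes $\{0,\dots,M\}^d$. Grid functions. $\mathbf E_h^0$ is the set of real functions on the grid vanishing at all boundary nodes (homogeneous Dirichlet). $\mathbf S_h^{(d)}$ is the set of symmetric trace-free $d\times d$ arrays with entries in $\mathbf E_h^0$. $\Delta_h$ is the standard $(2d+1)$-point discrete Laplacian, $\langle U,V\rangle_h=h^d\sum U V$ (sum over grid nodes), and $\|\nabla_hQ_h\|_h^2=-\sum_{i,j}\langle\Delta_hQ_h^{ij},Q_h^{ij}\rangle_h$. $\|Q_h\|_{F,\infty}$ is the maximum over grid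 nodes of the Frobenius norm of the matrix $Q_h$ at that node. Initial data. $Q^0:\overline\Omega\to\mathbb R^{d\times d}$ is symmetric and trace-free and vanishes on $\partial\Omega$; $\|Q^0\|_{L^\infty(\Omega)}=\sup_{x\in\Omega}|Q^0(x)|_F$ with $|\cdot|_F$ the Frobenius norm. $Q_h^0$ is the restriction of $Q^0$ to the grid, and $s^0=\mathcal E_{1h}[Q_h^0]$. Bounds. With $a_-=\max\{0,-a\}$, $$\eta^{(2)}=\max\Big\{\|Q^0\|_{L^\infty(\Omega)},\sqrt{a_-/c}\Big\},$$ $$\eta^{(3)}=\max\Big\{\|Q^0\|_{L^\infty(\Omega)},\frac{|b|+\sqrt{b^2-24ac}}{2\sqrt6\,c}\Big\}\ \text{if } a\le\frac{b^2}{24c},\qquad \eta^{(3)}=\|Q^0\|_{L^\infty(\Omega)}\ \text{otherwise.}$$ $\overline f(\xi)=-a\xi+\frac{b}{\sqrt6}\xi^2-c\xi^3$. Nonlinearity (at each node): $f(Q^{ij})=-aQ^{ij}+b\big((Q^2)^{ij}-\frac1d\operatorname{tr}(Q^2)\delta^{ij}\big)-c\operatorname{tr}(Q^2)Q^{ij}$. With $\mathcal F_{\rm bulk}(Q)=\frac a2\operatorname{tr}(Q^2)-\frac b3\operatorname{tr}(Q^3)+\frac c4\operatorname{tr}^2(Q^2)$, $\mathcal E_{1h}[Q_h]=\langle\mathcal F_{\rm bulk}(Q_h),1\rangle_h$ and $g(Q_h,s)=\exp\{s\}/\exp\{\mathcal E_{1h}[Q_h]\}$. $C_*>0$ is a fixed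 constant with $|\Omega|\mathcal F_{\rm bulk}(A)\ge-C_*$ for all symmetric trace-free $A\in\mathbb R^{d\times d}$. $E_{el}[Q_h]=\frac L2\|\nabla_hQ_h\|_h^2$, $E_h[Q_h,s]=E_{el}[Q_h]+s$, and $$G^*=\exp\{E_h[Q_h^0,\mathcal E_{1h}[Q_h^0]]+C_*\}.$$ First-order scheme. For $(P_h,\sigma)\in\mathbf S_h^{(d)}\times\mathbb R$ and $\theta>0$, $(P_h^+,\sigma^+)=\text{MBP-sESAV1}(P_h,\sigma,\theta)\in\mathbf S_h^{(d)}\times\mathbb R$ is defined by, for $1\le i,j\le d$ at interior nodes, $$\frac{P_h^{+,ij}-P_h^{ij}}{\theta}=L\Delta_hP_h^{+,ij}+g(P_h,\sigma)\big(f(P_h^{ij})-\kappa(P_h^{+,ij}-P_h^{ij})\big),$$ $$\tilde\sigma^+=\sigma-g(P_h,\sigma)\sum_{i,j=1}^d\langle f(P_h^{ij}),P_h^{+,ij}-P_h^{ij}\rangle_h,\qquad\sigma^+=\max\{\tilde\sigma^+,-C_*-E_{el}[P_h^+]\}.$$ Second-order scheme (MBP-sESAV2). Given $(Q_h^n,s^n)$, set $(Q_{*,h}^{n+1/2},s_*^{n+1/2})=\text{MBP-sESAV1}(Q_h^n,s^n,\tau/2)$, $g_*=g(Q_{*,h}^{n+1/2},s_*^{n+1/2})$ and $Q_h^{n+1/2}=(Q_h^{n+1}+Q_h^n)/2$. Then $(Q_h^{n+1},s^{n+1})\in\mathbf S_h^{(d)}\times\mathbb R$ is defined by, for $1\le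 i,j\le d$ at interior nodes, $$\Big(\big(\tfrac2\tau+\kappa g_*\big)I-L\Delta_h\Big)Q_h^{ij,n+1}=\Big(\big(\tfrac2\tau-\kappa g_*\big)I+L\Delta_h\Big)Q_h^{ij,n}+2g_*\big(\kappa Q_{*,h}^{ij,n+1/2}+f(Q_{*,h}^{ij,n+1/2})\big),$$ $$\tilde s^{n+1}=s^n-g_*\sum_{i,j=1}^d\langle f(Q_{*,h}^{ij,n+1/2}),Q_h^{ij,n+1}-Q_h^{ij,n}\rangle_h+\kappa g_*\sum_{i,j=1}^d\langle Q_h^{ij,n+1/2}-Q_{*,h}^{ij,n+1/2},Q_h^{ij,n+1}-Q_h^{ij,n}\rangle_h,$$ $$s^{n+1}=\max\{\tilde s^{n+1},-C_*-E_{el}[Q_h^{n+1}]\}.$$ *)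

(* Defs.v *)
From mathcomp Require Import all_boot all_order all_algebra.
From mathcomp Require Import all_classical all_reals all_analysis.

Set Implicit Arguments.
Unset Strict Implicit.
Unset Printing Implicit Defensive.

Import Order.TTheory GRing.Theory Num.Theory.
Import numFieldNormedType.Exports.

Local Open Scope classical_set_scope.
Local Open Scope ring_scope.

(* Real data of the model and of the schemes; no sign condition is built in. *)
Record params (R : realType) := Params {
  coef_a : R;
  coef_b : R;
  coef_c : R;
  elast1 : R;
  elast2 : R;
  elast3 : R;
  side : R;    (* the edge length L_d of Omega *)
  kappa : R;
  Cstar : R
}.

Definition elast (R : realType) (p : params R) : R :=
  elast1 p + (elast2 p + elast3 p) / 2.

Definition symtf (R : realType) (d : nat) (A : 'M[R]_d) : Prop :=
  A^T = A /\ \tr A = 0.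

Definition frob (R : realType) (d : nat) (A : 'M[R]_d) : R :=
  Num.sqrt (\sum_i \sum_j A i j ^+ 2).

Definition Omega (R : realType) (d : nat) (p : params R) : set 'rV[R]_d :=
  [set x | forall k, 0 <= x 0 k <= side p].

Definition bdOmega (R : realType) (d : nat) (p : params R) : set 'rV[R]_d :=
  [set x | Omega p x /\ exists k, x 0 k = 0 \/ x 0 k = side p].

Notation node d M := {ffun 'I_d -> 'I_M.+1}.

Definition interior_node (d M : nat) (x : node d M) : bool :=
  [forall k, (0 < x k)%N && (x k < M)%N].

(* The neighbours x + e_k and x - e_k; only meaningful at interior nodes. *)
Definition node_up (d M : nat) (x : node d M) (k : 'I_d) : node d M :=
  [ffun j => if j == k then inord (x j).+1 else x j].
Definition node_down (d M : nat) (x : node d M) (k : 'I_d) : node d M :=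
  [ffun j => if j == k then inord (x j).-1 else x j].

Definition mesh (R : realType) (p : params R) (M : nat) : R := side p / M%:R.

Definition node_pos (R : realType) (d M : nat) (p : params R) (x : node d M) :
    'rV[R]_d :=
  \row_k ((x k)%:R * mesh p M).

Definition grid_restr (R : realType) (d M : nat) (p : params R)
    (Q0 : 'rV[R]_d -> 'M[R]_d) : node d M -> 'M[R]_d :=
  fun x => Q0 (node_pos p x).

(* The space S_h^(d); grid tensors are functions on all nodes, boundary
   included. *)
Definition Sh (R : realType) (d M : nat) (Q : node d M -> 'M[R]_d) : Prop :=
  (forall x, symtf (Q x)) /\ (forall x, ~~ interior_node x -> Q x = 0).

Definition entry (R : realType) (d M : nat) (Q : node d M -> 'M[R]_d)
    (i j : 'I_d) : node d M -> R :=
  fun x => Q x i j.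

(* The value at boundary nodes is immaterial: the Laplacian is only evaluated at
   interior nodes or paired with grid functions vanishing on the boundary. *)
Definition lap (R : realType) (d M : nat) (p : params R) (U : node d M -> R) :
    node d M -> R :=
  fun x => if interior_node x then
    \sum_k (U (node_up x k) - 2 * U x + U (node_down x k)) / mesh p M ^+ 2
  else 0.

Definition inner (R : realType) (d M : nat) (p : params R)
    (U V : node d M -> R) : R :=
  mesh p M ^+ d * \sum_x U x * V x.

Definition tinner (R : realType) (d M : nat) (p : params R)
    (P Q : node d M -> 'M[R]_d) : R :=
  \sum_i \sum_j inner p (entry P i j) (entry Q i j).

Definition grad_normsq (R : realType) (d M : nat) (p : params R)
    (Q : node d M -> 'M[R]_d) : R :=
  - \sum_i \sum_j inner p (lap p (entry Q i j)) (entry Q i j).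

Definition normFinf (R : realType) (d M : nat) (Q : node d M -> 'M[R]_d) : R :=
  \big[Num.max/0]_x frob (Q x).

Definition bulk (R : realType) (d : nat) (p : params R) (A : 'M[R]_d) : R :=
  coef_a p / 2 * \tr (A *m A) - coef_b p / 3 * \tr (A *m A *m A)
  + coef_c p / 4 * \tr (A *m A) ^+ 2.

Definition nonlin (R : realType) (d : nat) (p : params R) (A : 'M[R]_d) :
    'M[R]_d :=
  - coef_a p *: A
  + coef_b p *: (A *m A - (d%:R^-1 * \tr (A *m A)) *: 1%:M)
  - (coef_c p * \tr (A *m A)) *: A.

Definition nonlinh (R : realType) (d M : nat) (p : params R)
    (Q : node d M -> 'M[R]_d) : node d M -> 'M[R]_d :=
  fun x => nonlin p (Q x).

Definition E1h (R : realType) (d M : nat) (p : params R)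
    (Q : node d M -> 'M[R]_d) : R :=
  inner p (fun x => bulk p (Q x)) (fun=> 1).

Definition gfac (R : realType) (d M : nat) (p : params R)
    (Q : node d M -> 'M[R]_d) (s : R) : R :=
  expR s / expR (E1h p Q).

Definition Eel (R : realType) (d M : nat) (p : params R)
    (Q : node d M -> 'M[R]_d) : R :=
  elast p / 2 * grad_normsq p Q.

Definition Eh (R : realType) (d M : nat) (p : params R)
    (Q : node d M -> 'M[R]_d) (s : R) : R :=
  Eel p Q + s.

Definition Gstar (R : realType) (d M : nat) (p : params R)
    (Qh0 : node d M -> 'M[R]_d) : R :=
  expR (Eh p Qh0 (E1h p Qh0) + Cstar p).

(* [side p ^+ d] is the volume |Omega|. *)
Definition bulk_lower_bound (R : realType) (d : nat) (p : params R) : Prop :=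
  forall A : 'M[R]_d, symtf A -> - Cstar p <= side p ^+ d * bulk p A.

(* [sup] is the actual supremum only for data bounded on Omega. *)
Definition normLinf (R : realType) (d : nat) (p : params R)
    (Q0 : 'rV[R]_d -> 'M[R]_d) : R :=
  sup [set frob (Q0 x) | x in Omega p].

Definition eta2 (R : realType) (d : nat) (p : params R)
    (Q0 : 'rV[R]_d -> 'M[R]_d) : R :=
  Num.max (normLinf p Q0) (Num.sqrt (Num.max 0 (- coef_a p) / coef_c p)).

Definition eta3 (R : realType) (d : nat) (p : params R)
    (Q0 : 'rV[R]_d -> 'M[R]_d) : R :=
  if coef_a p <= coef_b p ^+ 2 / (24 * coef_c p) then
    Num.max (normLinf p Q0)
      ((`|coef_b p| + Num.sqrt (coef_b p ^+ 2 - 24 * coef_a p * coef_c p))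
       / (2 * Num.sqrt 6 * coef_c p))
  else normLinf p Q0.

(* Only d = 2 and d = 3 are meaningful. *)
Definition eta (R : realType) (d : nat) (p : params R)
    (Q0 : 'rV[R]_d -> 'M[R]_d) : R :=
  if d == 2%N then eta2 p Q0 else eta3 p Q0.

Definition fbar (R : realType) (p : params R) (xi : R) : R :=
  - coef_a p * xi + coef_b p / Num.sqrt 6 * xi ^+ 2 - coef_c p * xi ^+ 3.

(* The maximum of |fbar'| over [0, e]; it is attained, fbar being a polynomial. *)
Definition max_dfbar (R : realType) (p : params R) (e : R) : R :=
  sup [set `| derive1 (fbar p) xi | | xi in `[0, e]].

(* Each step of the schemes is the relation between input and output given by
    the defining equations. *)

Definition sESAV1 (R : realType) (d M : nat) (p : params R)
    (P : node d M -> 'M[R]_d) (sigma theta : R)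
    (P' : node d M -> 'M[R]_d) (sigma' : R) : Prop :=
  let g := gfac p P sigma in
  let sigmat :=
    sigma - g * tinner p (nonlinh p P) (fun x => P' x - P x) in
  [/\ Sh P',
      forall x, interior_node x -> forall i j,
        (P' x i j - P x i j) / theta =
        elast p * lap p (entry P' i j) x
        + g * (nonlin p (P x) i j - kappa p * (P' x i j - P x i j))
    & sigma' = Num.max sigmat (- Cstar p - Eel p P')].

Definition sESAV2 (R : realType) (d M : nat) (p : params R) (tau : R)
    (Q : node d M -> 'M[R]_d) (s : R)
    (Q' : node d M -> 'M[R]_d) (s' : R) : Prop :=
  exists (Qs : node d M -> 'M[R]_d) (ss : R),
    sESAV1 p Q s (tau / 2) Qs ss /\
    let g := gfac p Qs ss in
    let dQ := fun x => Q' x - Q x in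
    let Qhalf := fun x => 2^-1 *: (Q' x + Q x) in
    let st := s - g * tinner p (nonlinh p Qs) dQ
              + kappa p * g * tinner p (fun x => Qhalf x - Qs x) dQ in
    [/\ Sh Q',
        forall x, interior_node x -> forall i j,
          (2 / tau + kappa p * g) * Q' x i j - elast p * lap p (entry Q' i j) x =
          (2 / tau - kappa p * g) * Q x i j + elast p * lap p (entry Q i j) x
          + 2 * g * (kappa p * Qs x i j + nonlin p (Qs x) i j)
      & s' = Num.max st (- Cstar p - Eel p Q')].

Definition sESAV2_sequence (R : realType) (d M : nat) (p : params R) (tau : R)
    (Q0 : 'rV[R]_d -> 'M[R]_d)
    (Q : nat -> node d M -> 'M[R]_d) (s : nat -> R) : Prop :=
  [/\ Q 0%N = grid_restr p Q0,
      s 0%N = E1h p (Q 0%N)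
    & forall n, sESAV2 p tau (Q n) (s n) (Q n.+1) (s n.+1)].

(* Main.v *)
Require Import Defs.
From mathcomp Require Import all_boot all_order all_algebra.
From mathcomp Require Import all_classical all_reals all_analysis.
From mathcomp Require Import ring lra.

(** The stabilized nonlinearity maps the ball of radius [eta] into the ball of
    radius [kappa * eta] ([stab_nonlin_le]): its Frobenius norm at [A] is at most
    [kappa * r + fbar r] with [r = frob A], this scalar function is nondecreasing
    because [kappa] dominates the derivative of [fbar], and [fbar eta <= 0].  In
    dimension 3 the term [A^2 - |A|^2 / 3] has norm exactly [|A|^2 / sqrt 6] for
    symmetric trace-free [A] ([frob_deviator]), so the triangle inequality is all
    that is needed.

    Both schemes invert a positive multiple of the identity minus a multiple of
    the discrete Laplacian, and such an operator obeys a maximum principle for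
    the Frobenius norm ([implicit_max_principle]).  For the first-order step the
    right-hand side is a combination, with the right total weight, of [P] and of
    the stabilized nonlinearity, so the bound [eta] passes to the predictor
    ([sESAV1_MBP]).  For the second-order step the right-hand side also contains
    an explicit operator, which preserves the bound once
    [2 / tau - kappa * g] is at least [2 * d * L / h^2]
    ([explicit_max_principle], [sESAV2_MBP]).

    The time-step condition gives exactly this provided that the factor [g] at
    the predictor is at most [Gstar].  That bound comes from the energy: the
    discrete Laplacian is symmetric and nonpositive on grid functions vanishing
    on the boundary ([laph_sym], [laph_le0]), hence both steps decrease
    [Eh] ([sESAV1_energy], [sESAV2_energy]), the elastic energy is nonnegative,
    and the bulk energy is at least [- Cstar] ([E1h_ge]); therefore
    [g = exp (s - E1h)] is at most [exp (Eh of the initial data + Cstar)]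
    ([gfac_le]).  The clipping of [s] is harmless since [- Cstar <= Eh] is
    preserved ([Eh_clip_le], [Eh_clip_ge]).  The theorem is the induction that
    carries the maximum bound and the two energy bounds together. *)

Set Implicit Arguments.
Unset Strict Implicit.
Unset Printing Implicit Defensive.

Import Order.TTheory GRing.Theory Num.Theory.
Import numFieldNormedType.Exports.

Local Open Scope classical_set_scope.
Local Open Scope ring_scope.

(** * Frobenius norm *)

Section Frobenius.
Variables (R : realType) (d : nat).
Implicit Types A B : 'M[R]_d.

Definition fdot A B : R := \sum_i \sum_j A i j * B i j.

Lemma fdotC A B : fdot A B = fdot B A.
Proof. by apply: eq_bigr => i _; apply: eq_bigr => j _; rewrite mulrC. Qed.

Lemma fdotDl A B C : fdot (A + B) C = fdot A C + fdot B C.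
Proof.
rewrite /fdot -big_split; apply: eq_bigr => i _.
by rewrite -big_split; apply: eq_bigr => j _; rewrite mxE mulrDl.
Qed.

Lemma fdotZl k A B : fdot (k *: A) B = k * fdot A B.
Proof.
rewrite /fdot mulr_sumr; apply: eq_bigr => i _.
by rewrite mulr_sumr; apply: eq_bigr => j _; rewrite mxE mulrA.
Qed.

Lemma fdotDr A B C : fdot A (B + C) = fdot A B + fdot A C.
Proof. by rewrite !(fdotC A) fdotDl. Qed.

Lemma fdotZr k A B : fdot A (k *: B) = k * fdot A B.
Proof. by rewrite !(fdotC A) fdotZl. Qed.

Lemma fdot0l B : fdot 0 B = 0.
Proof. by rewrite -(scale0r 0) fdotZl mul0r. Qed.

Lemma fdot0r A : fdot A 0 = 0.
Proof. by rewrite fdotC fdot0l. Qed.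

Lemma fdot_suml (I : finType) (F : I -> 'M[R]_d) B :
  fdot (\sum_k F k) B = \sum_k fdot (F k) B.
Proof.
exact: (big_morph (fdot^~ B) (fun _ _ => fdotDl _ _ _) (fdot0l B)).
Qed.

Lemma fdot_ge0 A : 0 <= fdot A A.
Proof. by do 2![apply: sumr_ge0 => ? _]; rewrite -expr2 sqr_ge0. Qed.

Lemma fdot_le_mean A B : 2 * fdot A B <= fdot A A + fdot B B.
Proof.
have := fdot_ge0 (A + -1 *: B).
by rewrite !(fdotDl, fdotDr, fdotZl, fdotZr) (fdotC B A); lra.
Qed.

Lemma frob_sqr A : frob A ^+ 2 = fdot A A.
Proof.
by rewrite /frob (_ : \sum_i _ = fdot A A) ?sqr_sqrtr ?fdot_ge0.
Qed.

Lemma frob_ge0 A : 0 <= frob A. Proof. exact: sqrtr_ge0. Qed.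

Lemma frob0 : frob (0 : 'M[R]_d) = 0.
Proof. by apply/eqP; rewrite -sqrf_eq0 frob_sqr fdot0l. Qed.

Lemma fdot_frob0 A B : frob A = 0 -> fdot A B = 0.
Proof.
move=> A0; have : fdot A A == 0 by rewrite -frob_sqr A0 expr0n.
rewrite psumr_eq0 => [/allP rows0|i _]; last first.
  by apply: sumr_ge0 => j _; rewrite -expr2 sqr_ge0.
apply: big1 => i _; apply: big1 => j _.
have := rows0 i (mem_index_enum i); rewrite /= psumr_eq0 => [/allP row0|k _].
  have := row0 j (mem_index_enum j); rewrite /= mulf_eq0 orbb => /eqP ->.
  by rewrite mul0r.
by rewrite -expr2 sqr_ge0.
Qed.

Lemma fdot_le_frob A B : fdot A B <= frob A * frob B.
Proof.
have [A0|A_neq0] := eqVneq (frob A) 0; first by rewrite fdot_frob0 ?A0 ?mul0r.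
have [B0|B_neq0] := eqVneq (frob B) 0.
  by rewrite fdotC fdot_frob0 ?B0 ?mulr0.
have AB_gt0 : 0 < frob A * frob B.
  by rewrite mulr_gt0 // lt_neqAle eq_sym frob_ge0 ?A_neq0 ?B_neq0.
(* Cauchy-Schwarz comes from expanding the square of this combination. *)
have := fdot_ge0 (frob B *: A + (- frob A) *: B).
rewrite !(fdotDl, fdotDr, fdotZl, fdotZr) -!frob_sqr (fdotC B A) => sq_ge0.
rewrite -(ler_pM2l AB_gt0); nra.
Qed.

Lemma frobD A B : frob (A + B) <= frob A + frob B.
Proof.
rewrite -ler_sqr ?nnegrE ?addr_ge0 ?frob_ge0 // frob_sqr fdotDl !fdotDr.
by rewrite -!frob_sqr (fdotC B A); have := fdot_le_frob A B; nra.
Qed.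

Lemma frobZ k A : frob (k *: A) = `|k| * frob A.
Proof.
apply/eqP; rewrite -(@eqrXn2 _ 2) ?mulr_ge0 ?frob_ge0 //.
rewrite frob_sqr fdotZl fdotZr exprMn real_normK ?num_real // frob_sqr.
by apply/eqP; ring.
Qed.

Lemma frobZ_ge0 k A : 0 <= k -> frob (k *: A) = k * frob A.
Proof. by move=> k0; rewrite frobZ ger0_norm. Qed.

Lemma frob_sum (I : finType) (F : I -> 'M[R]_d) :
  frob (\sum_k F k) <= \sum_k frob (F k).
Proof.
elim/big_ind2 : _ => [|A x B y Ax By|//]; first by rewrite frob0.
exact: le_trans (frobD _ _) (lerD Ax By).
Qed.

Lemma mxtrace_sqr A : A^T = A -> \tr (A *m A) = frob A ^+ 2.
Proof.
move=> symA; rewrite frob_sqr; apply: eq_bigr => i _; rewrite mxE.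
by apply: eq_bigr => j _; rewrite -{2}symA mxE.
Qed.

End Frobenius.

(** For a symmetric trace-free [A] of size 3, Cayley-Hamilton gives
    [tr (A^4) = |A|^4 / 2], so the deviator of [A^2] has squared norm
    [|A|^4 / 2 - |A|^4 / 3 = |A|^4 / 6].  This is where the factor [sqrt 6]
    of [fbar] comes from. *)
Lemma frob_deviator (R : realType) (A : 'M[R]_3) :
  symtf A ->
  frob (A *m A - (3^-1 * \tr (A *m A)) *: 1%:M) = frob A ^+ 2 / Num.sqrt 6.
Proof.
move=> [symA trA0].
have s6 : Num.sqrt 6 ^+ 2 = 6 :> R by rewrite sqr_sqrtr // ler0n.
apply/eqP; rewrite -(@eqrXn2 _ 2) ?divr_ge0 ?sqr_ge0 ?frob_ge0 ?sqrtr_ge0 //.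
rewrite exprMn exprVn s6 mxtrace_sqr // !frob_sqr; apply/eqP.
have sA i j : A i j = A j i by rewrite -{1}symA mxE.
move: trA0; rewrite /fdot /mxtrace.
(* Unfolds the finite sums and the matrix products down to entries of [A]. *)
do 30 rewrite ?mxE ?big_ord_recl ?big_ord0 /=.
set i2 : 'I_3 := lift ord0 (lift ord0 ord0).
set i1 : 'I_3 := lift ord0 ord0.
rewrite (sA i1 ord0) (sA i2 ord0) (sA i2 i1) => trA0.
have -> : A i2 i2 = - A ord0 ord0 - A i1 i1.
  by apply/eqP; rewrite -subr_eq0 -trA0; apply/eqP; ring.
by field.
Qed.

(** * Pointwise bound on the stabilized nonlinearity *)

Lemma derive1_fbar (R : realType) (p : params R) (x : R) :
  derive1 (fbar p) x =
  - coef_a p + 2 * (coef_b p / Num.sqrt 6) * x - 3 * coef_c p * x ^+ 2.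
Proof.
pose q : {poly R} := (- coef_a p)%:P * 'X + (coef_b p / Num.sqrt 6)%:P * 'X^2
  - (coef_c p)%:P * 'X^3.
have -> : fbar p = horner q.
  by apply/funext => y; rewrite /q !(hornerE, hornerXn) /fbar /=; ring.
by rewrite -derivE /q !poly.derivE !(hornerE, hornerXn) /=; ring.
Qed.

(** A supremum bounds its set only when the set has an upper bound; here one
    comes from the triangle inequality. *)
Lemma dfbar_le_max (R : realType) (p : params R) (e x : R) :
  0 <= x <= e -> `|derive1 (fbar p) x| <= max_dfbar p e.
Proof.
move=> /andP[x0 xe]; apply: ub_le_sup; last first.
  by exists x => //=; rewrite in_itv /= x0.
exists (`|coef_a p| + `|2 * (coef_b p / Num.sqrt 6)| * e
        + `|3 * coef_c p| * e ^+ 2).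
move=> _ [y /= + <-]; rewrite in_itv /= => /andP[y0 ye].
rewrite derive1_fbar; apply: le_trans (ler_normD _ _) _.
rewrite normrN (normrM _ (y ^+ 2)) lerD //; last first.
  rewrite ler_wpM2l // ger0_norm ?sqr_ge0 //.
  by rewrite lerXn2r ?nnegrE // (le_trans y0).
apply: le_trans (ler_normD _ _) _; rewrite normrN lerD // normrM.
by rewrite ler_wpM2l // ger0_norm.
Qed.

(** Adding [k * xi] with [k] above the slope of [fbar] makes the scalar
    nonlinearity nondecreasing on [0, e].  As [fbar] is cubic, Simpson's rule
    expresses its increment exactly by three values of its derivative. *)
Lemma stab_fbar_mono (R : realType) (p : params R) (k e r : R) :
  0 <= r <= e -> max_dfbar p e <= k -> k * r + fbar p r <= k * e + fbar p e.
Proof.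
move=> /andP[r0 re] dk.
have lb x : 0 <= x <= e -> - k <= derive1 (fbar p) x.
  by move=> /(dfbar_le_max p) /le_trans /(_ dk); rewrite ler_norml => /andP[].
have Hr := lb r; have Hm := lb ((r + e) / 2); have He := lb e.
have {}Hr : - k <= derive1 (fbar p) r by apply: Hr; rewrite r0 re.
have {}He : - k <= derive1 (fbar p) e by apply: He; lra.
have {}Hm : - k <= derive1 (fbar p) ((r + e) / 2) by apply: Hm; lra.
have simpson : fbar p e - fbar p r = (e - r) / 6 * (derive1 (fbar p) r
    + 4 * derive1 (fbar p) ((r + e) / 2) + derive1 (fbar p) e).
  by rewrite !derive1_fbar /fbar; field; rewrite sqrtr_eq0 -ltNge ltr0n.
suff : 0 <= (e - r) / 6 * (derive1 (fbar p) r
    + 4 * derive1 (fbar p) ((r + e) / 2) + derive1 (fbar p) e + 6 * k).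
  by rewrite mulrDr -simpson; lra.
by apply: mulr_ge0; lra.
Qed.

(** Holds for arbitrary data because [sup] is 0 on sets without supremum. *)
Lemma normLinf_ge0 (R : realType) (d : nat) (p : params R)
    (Q0 : 'rV[R]_d -> 'M[R]_d) : 0 <= normLinf p Q0.
Proof.
rewrite /normLinf; set E := (E in sup E).
have [supE|noE] := pselect (has_sup E); last first.
  by rewrite sup_out.
have [[r Er] ubE] := supE; apply: le_trans (ub_le_sup ubE Er).
by have [x _ <-] := Er; exact: frob_ge0.
Qed.

Lemma eta_ge_normLinf (R : realType) (d : nat) (p : params R)
    (Q0 : 'rV[R]_d -> 'M[R]_d) : normLinf p Q0 <= eta p Q0.
Proof.
rewrite /eta /eta2 /eta3; case: ifP => _; first by rewrite le_max lexx.
by case: ifP => // _; rewrite le_max lexx.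
Qed.

Lemma eta_ge0 (R : realType) (d : nat) (p : params R)
    (Q0 : 'rV[R]_d -> 'M[R]_d) : 0 <= eta p Q0.
Proof. exact: le_trans (normLinf_ge0 p Q0) (eta_ge_normLinf p Q0). Qed.

(** [eta] is at least the largest real root, if any, of the quadratic
    [xi |-> coef_a - coef_b / sqrt 6 * xi + coef_c * xi^2], and
    [fbar xi] is [- xi] times this quadratic. *)
Lemma fbar_eta_le0 (R : realType) (d : nat) (p : params R)
    (Q0 : 'rV[R]_d -> 'M[R]_d) :
  0 <= coef_b p -> 0 < coef_c p -> (d = 2%N -> coef_b p = 0) ->
  fbar p (eta p Q0) <= 0.
Proof.
move=> b0 c0 d2; have e0 := eta_ge0 p Q0; set e := eta p Q0 in e0 *.
have -> : fbar p e = - (e * (coef_a p - coef_b p / Num.sqrt 6 * e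
                             + coef_c p * e ^+ 2)) by rewrite /fbar; ring.
rewrite oppr_le0 mulr_ge0 //.
have [d2E|d_neq2] := eqVneq d 2%N.
  have : Num.sqrt (Num.max 0 (- coef_a p) / coef_c p) <= e.
    by rewrite /e /eta ifT ?d2E // /eta2 le_max lexx orbT.
  rewrite d2 // !mul0r subr0.
  have m0 : 0 <= Num.max 0 (- coef_a p) / coef_c p.
    by rewrite divr_ge0 ?le_max ?lexx // ltW.
  rewrite -ler_sqr ?nnegrE ?sqrtr_ge0 // sqr_sqrtr // ler_pdivrMr //.
  by rewrite ge_max => /andP[_]; rewrite mulrC; lra.
(* Completing the square: the quadratic is nonnegative at [e] as soon as the
   square below dominates its discriminant [D] (up to the factor 6). *)
set s : R := Num.sqrt 6; set D := coef_b p ^+ 2 - 24 * coef_a p * coef_c p.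
have s_gt0 : 0 < s by rewrite sqrtr_gt0 ltr0n.
have s2 : s ^+ 2 = 6 by rewrite sqr_sqrtr // ler0n.
have : D <= (2 * s * coef_c p * e - coef_b p) ^+ 2.
  have [D0|Dneg] := leP 0 D; last by rewrite (le_trans (ltW Dneg)) ?sqr_ge0.
  have : (`|coef_b p| + Num.sqrt D) / (2 * s * coef_c p) <= e.
    rewrite /e /eta (negPf d_neq2) /eta3 ifT ?le_max ?lexx ?orbT //.
    rewrite ler_pdivlMr; last by rewrite mulr_gt0 ?ltr0n.
    by move: D0; rewrite /D; lra.
  rewrite ler_pdivrMr; last by rewrite !mulr_gt0 ?ltr0n.
  rewrite ger0_norm // => De; have sD := sqrtr_ge0 D.
  by rewrite -(sqr_sqrtr D0) ler_sqr ?nnegrE ?sqrtr_ge0 //; lra.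
rewrite -subr_ge0.
have -> : (2 * s * coef_c p * e - coef_b p) ^+ 2 - D
    = (24 * coef_c p) * (coef_a p - coef_b p / s * e + coef_c p * e ^+ 2).
  have -> : coef_b p / s = coef_b p * s / 6.
    by rewrite -s2; field; exact: lt0r_neq0.
  apply/eqP; rewrite -subr_eq0; apply/eqP.
  transitivity (4 * (coef_c p * e) ^+ 2 * (s ^+ 2 - 6)).
    by rewrite /D; field.
  by rewrite s2 subrr mulr0.
by rewrite pmulr_rge0 // mulr_gt0 ?ltr0n.
Qed.

(** The pointwise estimate behind the maximum principle.  With [r = frob A],
    [k *: A + nonlin p A] is a nonnegative multiple of [A] plus [coef_b] times
    the deviator of [A^2], so the triangle inequality bounds it by
    [k * r + fbar p r], which is at most [k * e + fbar p e <= k * e]. *)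
Lemma stab_nonlin_le (R : realType) (d : nat) (p : params R) (k e : R)
    (A : 'M[R]_d) :
  0 <= coef_b p -> 0 < coef_c p -> (d = 2%N /\ coef_b p = 0) \/ d = 3%N ->
  coef_a p + coef_c p * e ^+ 2 <= k -> max_dfbar p e <= k -> fbar p e <= 0 ->
  symtf A -> frob A <= e -> frob (k *: A + nonlin p A) <= k * e.
Proof.
move=> b0 c0 dE ke dk fe symA Ae.
have A0 := frob_ge0 A.
set r := frob A in Ae A0 *.
have X0 : 0 <= k - coef_a p - coef_c p * r ^+ 2.
  suff : coef_c p * r ^+ 2 <= coef_c p * e ^+ 2 by lra.
  by rewrite ler_pM2l // ler_sqr ?nnegrE //; lra.
have trA : \tr (A *m A) = r ^+ 2 by apply: mxtrace_sqr; case: symA.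
pose B := A *m A - (d%:R^-1 * \tr (A *m A)) *: 1%:M.
have -> : k *: A + nonlin p A
    = (k - coef_a p - coef_c p * r ^+ 2) *: A + coef_b p *: B.
  by rewrite /nonlin -/B trA !scalerBl scaleNr !addrA [in RHS]addrAC.
have bB : frob (coef_b p *: B) = coef_b p / Num.sqrt 6 * r ^+ 2.
  rewrite frobZ_ge0 //; case: dE => [[_ ->]|d3]; first by rewrite !mul0r.
  by subst d; rewrite frob_deviator // mulrCA mulrC.
apply: le_trans (frobD _ _) _; rewrite bB frobZ_ge0 // -/r.
have := stab_fbar_mono (r := r) _ dk; rewrite A0 Ae => /(_ isT).
by rewrite {1}/fbar; nra.
Qed.

(** * Discrete Laplacian and maximum principles *)

Section Grid.
Variables (R : realType) (d M : nat) (p : params R).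
Implicit Types (x y : node d M) (k : 'I_d) (P Q : node d M -> 'M[R]_d).

Definition dirichlet P := forall x, ~~ interior_node x -> P x = 0.

Definition laph P : node d M -> 'M[R]_d :=
  fun x => \matrix_(i, j) lap p (entry P i j) x.

Lemma laphE P x : interior_node x ->
  laph P x = (mesh p M ^+ 2)^-1 *:
    \sum_k (P (node_up x k) + P (node_down x k) - 2 *: P x).
Proof.
move=> x_int; apply/matrixP => i j; rewrite !mxE summxE /lap x_int mulr_sumr.
by apply: eq_bigr => k _; rewrite !mxE /entry mulrC addrAC.
Qed.

Lemma tinnerE P Q :
  tinner p P Q = mesh p M ^+ d * \sum_x fdot (P x) (Q x).
Proof.
rewrite /tinner /inner /fdot [in RHS]exchange_big mulr_sumr.
apply: eq_bigr => i _; rewrite [in RHS]exchange_big mulr_sumr.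
by apply: eq_bigr => j _.
Qed.

Lemma grad_normsqE Q : grad_normsq p Q = - tinner p (laph Q) Q.
Proof.
congr (- _); apply: eq_bigr => i _; apply: eq_bigr => j _; congr (_ * _).
by apply: eq_bigr => x _; rewrite /entry mxE.
Qed.

Lemma tinner_linl a b P Q S T : (forall x, S x = a *: P x + b *: Q x) ->
  tinner p S T = a * tinner p P T + b * tinner p Q T.
Proof.
move=> SE; rewrite !tinnerE !(mulrCA _ (mesh p M ^+ d)) -mulrDr; congr (_ * _).
rewrite !mulr_sumr -big_split; apply: eq_bigr => x _.
by rewrite SE fdotDl !fdotZl.
Qed.

Lemma tinnerC P Q : tinner p P Q = tinner p Q P.
Proof. by rewrite !tinnerE; under eq_bigr do rewrite fdotC. Qed.

Lemma tinnerZl a P Q : tinner p (fun x => a *: P x) Q = a * tinner p P Q.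
Proof.
rewrite (@tinner_linl a 0 P P) ?mul0r ?addr0 // => x.
by rewrite scale0r addr0.
Qed.

Lemma tinner_linr a b P Q S T : (forall x, S x = a *: P x + b *: Q x) ->
  tinner p T S = a * tinner p T P + b * tinner p T Q.
Proof. by move=> SE; rewrite !(tinnerC T); exact: tinner_linl. Qed.

Lemma laph_lin a b P Q S : (forall x, S x = a *: P x + b *: Q x) ->
  forall x, laph S x = a *: laph P x + b *: laph Q x.
Proof.
move=> SE x; apply/matrixP => i j; rewrite !mxE /lap.
case: ifP => _; last by rewrite !mulr0 addr0.
rewrite !mulr_sumr -big_split; apply: eq_bigr => k _.
by rewrite /entry !SE !mxE /=; ring.
Qed.

Lemma eq_tinner_interior F G T : dirichlet T ->
  (forall x, interior_node x -> F x = G x) -> tinner p F T = tinner p G T.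
Proof.
move=> T0 FG; rewrite !tinnerE; congr (_ * _); apply: eq_bigr => x _.
by have [/FG -> //|/T0 ->] := boolP (interior_node x); rewrite !fdot0r.
Qed.

Lemma tinner_ge0 P : 0 <= mesh p M -> 0 <= tinner p P P.
Proof.
move=> h0; rewrite tinnerE mulr_ge0 ?exprn_ge0 //.
by apply: sumr_ge0 => x _; exact: fdot_ge0.
Qed.

Lemma node_upK x k : interior_node x -> node_down (node_up x k) k = x.
Proof.
move=> /forallP /(_ k) /andP[_ xM]; apply/ffunP => j; rewrite !ffunE.
by have [->|//] := eqVneq j k; apply/val_inj; rewrite /= !inordK // ltnW.
Qed.

Lemma node_downK x k : interior_node x -> node_up (node_down x k) k = x.
Proof.
move=> /forallP /(_ k) /andP[x0 xM]; apply/ffunP => j; rewrite !ffunE.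
have [->|//] := eqVneq j k; apply/val_inj; rewrite /=.
by rewrite !inordK ?prednK // (leq_trans (ltnW xM)).
Qed.

(** Discrete integration by parts in direction [k]: pairs (x + e_k, x) with both
    nodes interior are the pairs (y, y - e_k) with both nodes interior, and the
    vanishing of [f] discards all the others.  No boundary term is left. *)
Lemma sum_shift (f : node d M -> node d M -> R) k :
  (forall x y, ~~ (interior_node x && interior_node y) -> f x y = 0) ->
  \sum_(x | interior_node x) f (node_up x k) x
  = \sum_(x | interior_node x) f x (node_down x k).
Proof.
move=> f0.
rewrite [LHS](bigID (fun x => interior_node (node_up x k))) /= addrC big1.
  2: by move=> x /andP[xi upx]; rewrite f0 // (negPf upx).
rewrite [RHS](bigID (fun x => interior_node (node_down x k))) /= [RHS]addrC.
rewrite [X in _ = X + _]big1.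
  2: by move=> x /andP[xi downx]; rewrite f0 // (negPf downx) andbF.
rewrite !add0r [RHS](@reindex_onto _ _ _ _ (node d M)
  (@node_up d M ^~ k) (@node_down d M ^~ k)) /=; last first.
  by move=> x /andP[xi _]; exact: node_downK.
apply: eq_big => [x|x /andP[xi _]]; last by rewrite node_upK.
apply/andP/andP => [[xi upi]|[/andP[upi downi] /eqP xE]].
  by rewrite node_upK // upi xi.
by rewrite upi -{1}xE.
Qed.

Definition upform P Q k :=
  \sum_(x | interior_node x) fdot (P (node_up x k)) (Q x).

Lemma sum_fdot_down P Q k : dirichlet P -> dirichlet Q ->
  \sum_(x | interior_node x) fdot (P (node_down x k)) (Q x) = upform Q P k.
Proof.
move=> P0 Q0; rewrite [RHS](sum_shift (f := fun x y => fdot (Q x) (P y))).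
  by apply: eq_bigr => x _; rewrite fdotC.
by move=> x y; rewrite negb_and => /orP[/Q0|/P0] ->; rewrite ?fdot0l ?fdot0r.
Qed.

Lemma tinner_laph P Q : dirichlet P -> dirichlet Q ->
  tinner p (laph P) Q = mesh p M ^+ d * ((mesh p M ^+ 2)^-1 *
    \sum_k (upform P Q k + upform Q P k
            - 2 * \sum_(x | interior_node x) fdot (P x) (Q x))).
Proof.
move=> P0 Q0; rewrite tinnerE (bigID (@interior_node d M)) /= addrC big1 ?add0r.
  2: by move=> x /Q0 ->; rewrite fdot0r.
congr (_ * _); under eq_bigr => x xi do rewrite laphE // fdotZl fdot_suml.
rewrite -mulr_sumr exchange_big; congr (_ * _); apply: eq_bigr => k _.
rewrite -(sum_fdot_down k P0 Q0) /upform mulr_sumr -big_split -sumrB.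
by apply: eq_bigr => x _; rewrite !fdotDl -scaleNr fdotZl mulNr.
Qed.

(** By [tinner_laph], the form is visibly symmetric in its two arguments. *)
Lemma laph_sym P Q : dirichlet P -> dirichlet Q ->
  tinner p (laph P) Q = tinner p (laph Q) P.
Proof.
move=> P0 Q0; rewrite !tinner_laph //; congr (_ * (_ * _)).
apply: eq_bigr => k _; rewrite (addrC (upform P Q k)); congr (_ - _ * _).
by apply: eq_bigr => x _; rewrite fdotC.
Qed.

(** Each product of neighbouring values is at most the mean of their squares,
    and shifting the grid does not increase the sum of the squares. *)
Lemma laph_le0 P : 0 <= mesh p M -> dirichlet P -> tinner p (laph P) P <= 0.
Proof.
move=> h0 P0; rewrite tinner_laph // mulr_ge0_le0 ?exprn_ge0 //.
rewrite mulr_ge0_le0 ?invr_ge0 ?exprn_ge0 //; apply: sumr_le0 => k _.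
have up_le : \sum_(x | interior_node x) fdot (P (node_up x k)) (P (node_up x k))
    <= \sum_(x | interior_node x) fdot (P x) (P x).
  pose f x y := if interior_node y then fdot (P x) (P x) else 0.
  rewrite (eq_bigr (fun x => f (node_up x k) x)); last first.
    by move=> x xi; rewrite /f xi.
  rewrite sum_shift => [|x y]; last first.
    rewrite negb_and /f => /orP[/P0 ->|/negPf -> //].
    by rewrite fdot0l if_same.
  by apply: ler_sum => x _; rewrite /f; case: ifP => // _; exact: fdot_ge0.
suff : 2 * upform P P k <=
    \sum_(x | interior_node x) fdot (P (node_up x k)) (P (node_up x k))
    + \sum_(x | interior_node x) fdot (P x) (P x) by lra.
rewrite mulr_sumr -big_split; apply: ler_sum => x _; exact: fdot_le_mean.
Qed.

(** At a node where the Frobenius norm of [P] is maximal, Cauchy-Schwarz shows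
    that the Laplacian of [P] has a nonpositive product with [P], so pairing the
    equation with [P] at this node bounds the maximum.  The argument is
    tensorial: the entries are not treated separately. *)
Lemma implicit_max_principle P (G : node d M -> 'M[R]_d) (alpha l e : R) :
  0 <= l -> 0 < alpha -> 0 <= e -> dirichlet P ->
  (forall x, interior_node x -> alpha *: P x - l *: laph P x = G x) ->
  (forall x, interior_node x -> frob (G x) <= alpha * e) ->
  forall x, frob (P x) <= e.
Proof.
move=> l0 alpha0 e0 P0 eqP Ge x1.
have [x _ x_max] := @arg_maxP _ _ _ x1 xpredT (fun x => frob (P x)) isT.
apply: le_trans (x_max x1 isT) _ => /=.
have [x_int|/P0 ->] := boolP (interior_node x); last by rewrite frob0.
have [Px0|Px_neq0] := eqVneq (frob (P x)) 0; first by rewrite Px0.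
have Px_gt0 : 0 < frob (P x) by rewrite lt_neqAle eq_sym Px_neq0 frob_ge0.
have nb y : fdot (P y) (P x) <= frob (P x) ^+ 2.
  rewrite (le_trans (fdot_le_frob _ _)) // expr2 ler_wpM2r ?frob_ge0 //.
  exact: x_max.
have lap_le0 : fdot (laph P x) (P x) <= 0.
  rewrite laphE // fdotZl fdot_suml mulr_ge0_le0 ?invr_ge0 ?sqr_ge0 //.
  apply: sumr_le0 => k _; rewrite !fdotDl -scaleNr fdotZl -frob_sqr.
  by have := nb (node_up x k); have := nb (node_down x k); lra.
have : fdot (G x) (P x) <= alpha * e * frob (P x).
  by rewrite (le_trans (fdot_le_frob _ _)) // ler_wpM2r ?frob_ge0 ?Ge.
rewrite -eqP // fdotDl -scaleNr !fdotZl -frob_sqr mulNr => GP.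
have : alpha * (frob (P x) * frob (P x)) <= alpha * (e * frob (P x)).
  by have : 0 <= - (l * fdot (laph P x) (P x));
    [rewrite oppr_ge0 mulr_ge0_le0|lra].
by rewrite ler_pM2l // ler_pM2r.
Qed.

(** Under this condition on [beta] the explicit operator has nonnegative
    coefficients at the node and at its [2 d] neighbours, adding up to [beta]. *)
Lemma explicit_max_principle P (beta l e : R) x :
  0 <= l -> 2 * d%:R * l / mesh p M ^+ 2 <= beta ->
  (forall y, frob (P y) <= e) -> interior_node x ->
  frob (beta *: P x + l *: laph P x) <= beta * e.
Proof.
move=> l0 beta_ge Pe x_int; set w := l / mesh p M ^+ 2.
have w0 : 0 <= w by rewrite divr_ge0 ?sqr_ge0.
have -> : beta *: P x + l *: laph P x = (beta - 2 * d%:R * w) *: P x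
    + w *: \sum_k (P (node_up x k) + P (node_down x k)).
  rewrite laphE // sumrB sumr_const card_ord scalerA -/w scalerBr addrA addrAC.
  congr (_ + _); rewrite scalerBl -scaler_nat !scalerA.
  by congr (_ - _ *: _); ring.
have c0 : 0 <= beta - 2 * d%:R * w by rewrite subr_ge0 /w mulrA.
apply: le_trans (frobD _ _) _; rewrite !frobZ_ge0 //.
have sum_le : frob (\sum_k (P (node_up x k) + P (node_down x k)))
    <= 2 * d%:R * e.
  apply: le_trans (frob_sum _) _.
  apply: (@le_trans _ _ (\sum_(k < d) (e + e))).
    by apply: ler_sum => k _; apply: le_trans (frobD _ _) (lerD (Pe _) (Pe _)).
  by rewrite sumr_const card_ord -[leLHS]mulr_natr; lra.
have := ler_wpM2l c0 (Pe x); have := ler_wpM2l w0 sum_le; nra.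
Qed.

End Grid.

(** * Energy dissipation and the bound on the auxiliary factor *)

Section Energy.
Variables (R : realType) (d M : nat) (p : params R).
Hypotheses (h0 : 0 <= mesh p M) (L0 : 0 <= elast p) (k0 : 0 <= kappa p).
Implicit Types (x : node d M) (P Q : node d M -> 'M[R]_d).

Lemma Sh_dirichlet P : Sh P -> dirichlet P. Proof. by case. Qed.

Lemma dirichletB P Q :
  dirichlet P -> dirichlet Q -> dirichlet (fun x => P x - Q x).
Proof. by move=> P0 Q0 x xb; rewrite P0 // Q0 // subrr. Qed.

Lemma gfac_gt0 P s : 0 < gfac p P s.
Proof. by rewrite divr_gt0 ?expR_gt0. Qed.

Lemma Eel_ge0 P : dirichlet P -> 0 <= Eel p P.
Proof.
move=> P0; rewrite /Eel grad_normsqE mulr_ge0 ?divr_ge0 // oppr_ge0.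
exact: laph_le0.
Qed.

(** Clipping the auxiliary variable raises the energy at most to [- Cstar],
    which lies below the energy of the previous step.  Together with
    [Eh_clip_ge] this makes [- Cstar <= Eh] an invariant. *)
Lemma Eh_clip_le P st E : - Cstar p <= E -> Eel p P + st <= E ->
  Eh p P (Num.max st (- Cstar p - Eel p P)) <= E.
Proof. by move=> CE stE; rewrite /Eh addr_maxr ge_max stE; lra. Qed.

Lemma Eh_clip_ge P st : - Cstar p <= Eh p P (Num.max st (- Cstar p - Eel p P)).
Proof. by rewrite /Eh addr_maxr le_max; apply/orP; right; lra. Qed.

Lemma sESAV1_mx P s theta P' s' : sESAV1 p P s theta P' s' ->
  forall x, interior_node x ->
    theta^-1 *: (P' x - P x) = elast p *: laph p P' x
      + gfac p P s *: (nonlin p (P x) - kappa p *: (P' x - P x)).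
Proof.
move=> [_ eqn _] x x_int; apply/matrixP => i j.
by have := eqn x x_int i j; rewrite !mxE => <-; rewrite mulrC.
Qed.

(** Pairing the scheme with the increment [D] gives the value of the nonlinear
    term subtracted from [s]; before clipping, the new energy is therefore
    [Eh p P s - (theta^-1 + g * kappa p) * |D|^2 - elast p / 2 * |grad D|^2]. *)
Lemma sESAV1_energy P s theta P' s' : 0 < theta -> Sh P ->
  - Cstar p <= Eh p P s -> sESAV1 p P s theta P' s' ->
  Eh p P' s' <= Eh p P s.
Proof.
move=> theta0 /Sh_dirichlet P0 CE step.
have eqn := sESAV1_mx step; have [/Sh_dirichlet P'0 _ ->] := step.
apply: Eh_clip_le => //; rewrite /Eh /Eel !grad_normsqE.
set g := gfac p P s in eqn *; have g0 : 0 < g := gfac_gt0 P s.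
pose D x := P' x - P x.
have DE x : D x = 1 *: P' x + (-1) *: P x by rewrite scale1r scaleN1r.
have D0 : dirichlet D by exact: dirichletB.
rewrite -/D.
have balance : theta^-1 * tinner p D D = elast p * tinner p (laph p P') D
    + g * (tinner p (nonlinh p P) D - kappa p * tinner p D D).
  rewrite -(tinnerZl p theta^-1).
  rewrite (eq_tinner_interior p (F := fun x => theta^-1 *: D x) D0 eqn).
  rewrite (tinner_linl p (a := elast p) (b := g) (P := laph p P')
    (Q := fun x => nonlin p (P x) - kappa p *: D x)) //.
  rewrite (tinner_linl p (a := 1) (b := - kappa p) (P := nonlinh p P) (Q := D)
    (S := fun x => nonlin p (P x) - kappa p *: D x)).
    by rewrite mul1r mulNr.
  by move=> x; rewrite scale1r scaleNr.
have lapD T : tinner p (laph p D) T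
    = 1 * tinner p (laph p P') T + (-1) * tinner p (laph p P) T.
  exact/tinner_linl/laph_lin.
have innD T : tinner p T D = 1 * tinner p T P' + (-1) * tinner p T P.
  exact: tinner_linr.
have lapDD_le0 := mulr_ge0_le0 L0 (laph_le0 h0 D0).
have DD_ge0 : 0 <= (theta^-1 + g * kappa p) * tinner p D D.
  by rewrite mulr_ge0 ?tinner_ge0 // addr_ge0 ?invr_ge0 ?mulr_ge0 // ltW.
have symPP' := laph_sym p P'0 P0.
rewrite lapD !(innD (laph p _)) in lapDD_le0.
rewrite (innD (laph p _)) in balance.
by move: balance lapDD_le0 DD_ge0; rewrite symPP'; lra.
Qed.

(** This is a Crank-Nicolson step: the Laplacian acts on the
    midpoint, so its product with the increment is exactly the change of the
    elastic energy, and the correction term of [s] cancels the stabilization.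
    Before clipping, only [- |D|^2 / tau] is left. *)
Lemma sESAV2_energy tau Q s Q' s' : 0 < tau -> Sh Q ->
  - Cstar p <= Eh p Q s -> sESAV2 p tau Q s Q' s' ->
  Eh p Q' s' <= Eh p Q s.
Proof.
move=> tau0 /Sh_dirichlet Q0 CE [Qs [ss [_]]].
set g := gfac p Qs ss; have g0 : 0 < g := gfac_gt0 Qs ss.
move=> /= [/Sh_dirichlet Q'0 eqn ->].
apply: Eh_clip_le => //; rewrite /Eh /Eel !grad_normsqE.
pose D x := Q' x - Q x; rewrite -/D.
have DE x : D x = 1 *: Q' x + (-1) *: Q x by rewrite scale1r scaleN1r.
have D0 : dirichlet D by exact: dirichletB.
have innD T : tinner p T D = 1 * tinner p T Q' + (-1) * tinner p T Q.
  exact: tinner_linr.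
have balance : (2 / tau + kappa p * g) * tinner p Q' D
      - elast p * tinner p (laph p Q') D
    = (2 / tau - kappa p * g) * tinner p Q D + elast p * tinner p (laph p Q) D
      + 2 * g * (kappa p * tinner p Qs D + tinner p (nonlinh p Qs) D).
  rewrite -mulNr -(tinner_linl p (S := fun x =>
    (2 / tau + kappa p * g) *: Q' x + (- elast p) *: laph p Q' x)) //.
  rewrite (eq_tinner_interior p D0 (G := fun x =>
      1 *: ((2 / tau - kappa p * g) *: Q x + elast p *: laph p Q x)
      + (2 * g) *: (kappa p *: Qs x + 1 *: nonlinh p Qs x))).
    by rewrite !(tinner_linl _ _ (fun x => erefl)) !mul1r.
  move=> x x_int; apply/matrixP => i j; have := eqn x x_int i j.
  by rewrite !mxE; lra.
have mid : tinner p (fun x => 2^-1 *: (Q' x + Q x) - Qs x) D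
    = 2^-1 * (tinner p Q' D + tinner p Q D) - tinner p Qs D.
  rewrite (tinner_linl p (a := 2^-1) (b := -1)
    (P := fun x => Q' x + Q x) (Q := Qs)).
    rewrite (tinner_linl p (a := 1) (b := 1) (P := Q') (Q := Q)) => [|x].
      by rewrite !mul1r mulN1r.
    by rewrite !scale1r.
  by move=> x; rewrite scaleN1r.
have DD : tinner p D D = 1 * tinner p Q' D + (-1) * tinner p Q D.
  exact: tinner_linl.
have DD_ge0 : 0 <= tau^-1 * tinner p D D.
  by rewrite mulr_ge0 ?tinner_ge0 // invr_ge0 ltW.
have symQQ' := laph_sym p Q'0 Q0.
rewrite mid; rewrite DD in DD_ge0; rewrite !(innD (laph p _)) in balance.
by move: balance DD_ge0; rewrite symQQ'; lra.
Qed.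

(** No coordinate of an interior node is the last index, which leaves [M]
    choices in each direction. *)
Lemma card_interior : (#|@interior_node d M| <= M ^ d)%N.
Proof.
have cardM : #|predC1 (@ord_max M)| = M.
  by have := cardC1 (@ord_max M); rewrite card_ord.
rewrite -[X in (_ ^ X)%N]card_ord -[X in (X ^ _)%N]cardM -card_ffun_on.
apply: subset_leq_card; apply/fintype.subsetP => x /forallP x_int.
apply/ffun_onP => k; rewrite !inE; apply/eqP => xkE.
by have := x_int k; rewrite xkE ltnn andbF.
Qed.

(** Boundary nodes contribute nothing as [bulk p 0 = 0], and the interior nodes
    are few enough, by [card_interior], for their cells to fit into the domain. *)
Lemma E1h_ge P : (0 < M)%N -> 0 < side p -> 0 <= Cstar p ->
  bulk_lower_bound d p -> Sh P -> - Cstar p <= E1h p P.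
Proof.
move=> M0 s0 C0 lb [symP P0].
have sd0 : 0 < side p ^+ d by rewrite exprn_gt0.
have bulk_ge x : - Cstar p / side p ^+ d <= bulk p (P x).
  by rewrite ler_pdivrMr // mulrC lb.
rewrite /E1h /inner (bigID (@interior_node d M)) /= [X in _ + X]big1 ?addr0.
  2: move=> x /P0 ->; rewrite /bulk !mulmx0 mxtrace0 expr0n /= !mulr0.
  2: by rewrite subrr addr0 mul0r.
apply: (@le_trans _ _ (mesh p M ^+ d *
    \sum_(x | @interior_node d M x) (- Cstar p / side p ^+ d))).
  rewrite sumr_const -mulr_natr /mesh expr_div_n.
  set N : R := #|_|%:R.
  have NM : N <= M%:R ^+ d by rewrite -natrX ler_nat card_interior.
  have Md0 : 0 < M%:R ^+ d :> R by rewrite exprn_gt0 ?ltr0n.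
  have -> : side p ^+ d / M%:R ^+ d * (- Cstar p / side p ^+ d * N)
      = - (Cstar p * (N / M%:R ^+ d)).
    by field; rewrite !lt0r_neq0.
  by rewrite lerN2 ler_piMr // ler_pdivrMr // mul1r.
rewrite ler_wpM2l ?exprn_ge0 //; apply: ler_sum => x _; by rewrite mulr1.
Qed.

(** The exponential form of the auxiliary factor turns the energy bound into an
    a priori bound, with [Gstar] as the right-hand side for [E] the initial
    energy. *)
Lemma gfac_le P s E : dirichlet P -> - Cstar p <= E1h p P -> Eh p P s <= E ->
  gfac p P s <= expR (E + Cstar p).
Proof.
move=> P0 CE hE; rewrite /gfac -expRN -expRD ler_expR.
by have := Eel_ge0 P0; move: hE; rewrite /Eh; lra.
Qed.

End Energy.

(** * Initial data and preservation of the maximum bound *)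

Section InitialData.
Variables (R : realType) (d M : nat) (p : params R) (Q0 : 'rV[R]_d -> 'M[R]_d).
Hypotheses (side0 : 0 < side p) (M0 : (0 < M)%N).

Lemma node_pos_Omega (x : node d M) : Omega p (node_pos p x).
Proof.
move=> k; rewrite mxE /mesh mulr_ge0 ?divr_ge0 ?(ltW side0) //=.
rewrite mulrCA ler_piMr ?(ltW side0) // ler_pdivrMr ?ltr0n // mul1r ler_nat.
by rewrite -ltnS.
Qed.

Lemma node_pos_bdOmega (x : node d M) :
  ~~ interior_node x -> bdOmega p (node_pos p x).
Proof.
move=> /forallPn[k]; rewrite negb_and -!leqNgt => xk.
split; first exact: node_pos_Omega.
exists k; rewrite mxE /mesh; case/orP: xk => [|Mx].
  by rewrite leqn0 => /eqP ->; left; rewrite mul0r.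
have -> : (x k : nat) = M by apply/eqP; rewrite eqn_leq -ltnS ltn_ord.
by right; rewrite mulrC divfK // pnatr_eq0 -lt0n.
Qed.

Lemma Sh_grid_restr :
  (forall x, Omega p x -> symtf (Q0 x)) ->
  (forall x, bdOmega p x -> Q0 x = 0) ->
  Sh (grid_restr p Q0 : node d M -> 'M[R]_d).
Proof.
move=> symQ bdQ; split=> x; first exact/symQ/node_pos_Omega.
by move=> x_bd; exact/bdQ/node_pos_bdOmega.
Qed.

Lemma grid_restr_le_eta :
  (exists B : R, forall x, Omega p x -> frob (Q0 x) <= B) ->
  forall x : node d M, frob (grid_restr p Q0 x) <= eta p Q0.
Proof.
move=> [B ubB] x; apply: le_trans (eta_ge_normLinf p Q0).
apply: ub_le_sup; first by exists B => _ [y /ubB ? <-].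
by exists (node_pos p x) => //; exact: node_pos_Omega.
Qed.

End InitialData.

Section MBP.
Variables (R : realType) (d M : nat) (p : params R) (e : R).
Hypotheses (L0 : 0 <= elast p) (k0 : 0 <= kappa p) (e0 : 0 <= e).
Hypothesis stab : forall A : 'M[R]_d, symtf A -> frob A <= e ->
  frob (kappa p *: A + nonlin p A) <= kappa p * e.
Implicit Types P Q : node d M -> 'M[R]_d.

(** [alpha = theta^-1 + g * kappa] matches the total weight of the right-hand
    side, so no restriction on [theta] arises. *)
Lemma sESAV1_MBP P s theta P' s' :
  0 < theta -> Sh P ->
  sESAV1 p P s theta P' s' ->
  (forall x, frob (P x) <= e) -> forall x, frob (P' x) <= e.
Proof.
move=> theta0 [symP _] step Pe; have eqn := sESAV1_mx step.
have [/Sh_dirichlet P'0 _ _] := step.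
set g := gfac p P s in eqn; have g0 : 0 < g := gfac_gt0 p P s.
have t0 : 0 < theta^-1 by rewrite invr_gt0.
apply: (implicit_max_principle (p := p) (l := elast p)
  (alpha := theta^-1 + g * kappa p)
  (G := fun x => theta^-1 *: P x
     + g *: (kappa p *: P x + nonlin p (P x)))) => //.
- by rewrite ltr_pwDl // mulr_ge0 // ltW.
- move=> x x_int; have /matrixP eqx := eqn x x_int.
  by apply/matrixP => i j; have := eqx i j; rewrite !mxE; lra.
move=> x _; apply: le_trans (frobD _ _) _.
rewrite !frobZ_ge0 ?(ltW t0) ?(ltW g0) // mulrDl -mulrA lerD //.
  by rewrite ler_pM2l.
by rewrite ler_pM2l // stab.
Qed.

(** The stabilization enters the explicit half of the step with a minus sign,
    so [2 / tau] must dominate both the Laplacian and [kappa] times the factor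
    [g]; hence the hypotheses on the bound [G]. *)
Lemma sESAV2_MBP tau Q s Q' s' (G : R) : 0 < tau -> Sh Q ->
  sESAV2 p tau Q s Q' s' -> (forall x, frob (Q x) <= e) ->
  (forall Qs ss, sESAV1 p Q s (tau / 2) Qs ss -> gfac p Qs ss <= G) ->
  2 * d%:R * elast p / mesh p M ^+ 2 <= 2 / tau - kappa p * G ->
  forall x, frob (Q' x) <= e.
Proof.
move=> tau0 ShQ [Qs [ss [step1 step2]]] Qe gG cfl; move: step2 => /=.
have Qse : forall x, frob (Qs x) <= e.
  by apply: sESAV1_MBP step1 Qe => //; rewrite divr_gt0.
have {}gG := gG _ _ step1; have [[symQs _] _ _] := step1.
set g := gfac p Qs ss in gG *; have g0 : 0 < g := gfac_gt0 p Qs ss.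
move=> [/Sh_dirichlet Q'0 eqn _].
have kg : kappa p * g <= kappa p * G by rewrite ler_wpM2l.
have t0 : 0 < 2 / tau by rewrite divr_gt0.
apply: (implicit_max_principle (p := p) (l := elast p)
  (alpha := 2 / tau + kappa p * g)
  (G := fun x => ((2 / tau - kappa p * g) *: Q x + elast p *: laph p Q x)
     + (2 * g) *: (kappa p *: Qs x + nonlin p (Qs x)))) => //.
- by rewrite ltr_pwDl // mulr_ge0 // ltW.
- move=> x x_int; apply/matrixP => i j; have := eqn x x_int i j.
  by rewrite !mxE; lra.
move=> x x_int; apply: le_trans (frobD _ _) _.
have lin : frob ((2 / tau - kappa p * g) *: Q x + elast p *: laph p Q x)
    <= (2 / tau - kappa p * g) * e.
  by apply: explicit_max_principle => //; lra.
have : frob ((2 * g) *: (kappa p *: Qs x + nonlin p (Qs x)))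
    <= 2 * g * (kappa p * e).
  by rewrite frobZ_ge0 ?ler_wpM2l ?stab // mulr_ge0 // ltW.
by move: lin; lra.
Qed.

End MBP.

Theorem theorem3p4 (R : realType) (d M : nat) (p : params R) (tau : R)
    (Q0 : 'rV[R]_d -> 'M[R]_d)
    (Q : nat -> node d M -> 'M[R]_d) (s : nat -> R)
    (hb : 0 <= coef_b p) (hc : 0 < coef_c p) (hL : 0 < elast p)
    (hdim : (d = 2%N /\ coef_b p = 0) \/
            (d = 3%N /\ elast2 p + elast3 p = 0))
    (hside : 0 < side p) (hM : (0 < M)%N)
    (hC0 : 0 < Cstar p) (hC : bulk_lower_bound d p)
    (hQ0sym : forall x, Omega p x -> symtf (Q0 x))
    (hQ0bd : forall x, bdOmega p x -> Q0 x = 0)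
    (hQ0bnd : exists B : R, forall x, Omega p x -> frob (Q0 x) <= B)
    (hkappa : Num.max (coef_a p + coef_c p * eta p Q0 ^+ 2)
                      (max_dfbar p (eta p Q0)) <= kappa p)
    (htau0 : 0 < tau)
    (htau : tau <= (kappa p * Gstar p (grid_restr (M := M) p Q0) / 2
                    + 2 ^+ d.-1 * elast p / mesh p M ^+ 2)^-1)
    (hQ : sESAV2_sequence p tau Q0 Q s) :
  forall n, normFinf (Q n) <= eta p Q0.
Proof.
have e0 := eta_ge0 p Q0; set e := eta p Q0 in hkappa e0 *.
have [k_lin k_df] :
    coef_a p + coef_c p * e ^+ 2 <= kappa p /\ max_dfbar p e <= kappa p.
  by move: hkappa; rewrite ge_max => /andP.
have k0 : 0 <= kappa p.
  apply: le_trans k_df.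
  by apply: le_trans (dfbar_le_max p (x := 0) _); rewrite ?lexx.
have L0 := ltW hL; have C0 := ltW hC0.
have h_gt0 : 0 < mesh p M by rewrite divr_gt0 ?ltr0n.
have h0 := ltW h_gt0.
have d23 : (d = 2%N /\ coef_b p = 0) \/ d = 3%N.
  by case: hdim => [|[]]; [left|right].
have fe : fbar p e <= 0.
  by apply: fbar_eta_le0 => //; case: d23 => [[_ ->]|->].
have stab (A : 'M[R]_d) : symtf A -> frob A <= e ->
    frob (kappa p *: A + nonlin p A) <= kappa p * e by exact: stab_nonlin_le.
have [Q00 s00 step] := hQ.
set G := Gstar p _ in htau.
have ShQ00 := Sh_grid_restr hside hM hQ0sym hQ0bd; rewrite -Q00 in ShQ00.
have E1h_low (P : node d M -> 'M[R]_d) : Sh P -> - Cstar p <= E1h p P.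
  exact: E1h_ge.
have G_gt0 : 0 < G by exact: expR_gt0.
have cfl : 2 * d%:R * elast p / mesh p M ^+ 2 <= 2 / tau - kappa p * G.
  set w := elast p / mesh p M ^+ 2.
  have w0 : 0 < w by rewrite divr_gt0 ?exprn_gt0.
  have rate0 : 0 < kappa p * G / 2 + 2 ^+ d.-1 * elast p / mesh p M ^+ 2.
    rewrite ltr_wpDl ?divr_ge0 ?mulr_ge0 // ?(ltW G_gt0) //.
    by rewrite -mulrA mulr_gt0 ?exprn_gt0.
  have : kappa p * G / 2 + 2 ^+ d.-1 * w <= tau^-1.
    by rewrite /w mulrA -(invrK (_ + _)) lef_pV2 ?posrE ?invr_gt0.
  (* This is where [d <= 2 ^ (d - 1)] enters, for [d] equal to 2 or 3. *)
  have : d%:R * w <= 2 ^+ d.-1 * w.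
    by rewrite ler_wpM2r ?(ltW w0) // -natrX ler_nat; case: d23 => [[->]|->].
  by rewrite -(mulrA (2 * _)) -/w; lra.
(* The energy bounds belong to the invariant because the explicit half
   of the step is monotone only as long as [gfac] stays below [G]. *)
have inv n : [/\ Sh (Q n), forall x, frob (Q n x) <= e
    & - Cstar p <= Eh p (Q n) (s n) <= Eh p (Q 0%N) (s 0%N)].
  elim: n => [|n [ShQ Qe /andP[lowE uppE]]].
    split=> // [x|]; first by rewrite Q00; exact: grid_restr_le_eta.
    rewrite lexx andbT s00 /Eh; have := E1h_low _ ShQ00.
    by have := Eel_ge0 h0 L0 (Sh_dirichlet ShQ00); lra.
  have stepn := step n.
  have E_le := sESAV2_energy h0 htau0 ShQ lowE stepn.
  have gG Qs ss : sESAV1 p (Q n) (s n) (tau / 2) Qs ss -> gfac p Qs ss <= G.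
    move=> step1; have [ShQs _ _] := step1.
    rewrite /G /Gstar -Q00 -s00; apply: gfac_le => //.
    - exact: Sh_dirichlet.
    - exact: E1h_low.
    apply: le_trans uppE; apply: sESAV1_energy step1 => //.
    by rewrite divr_gt0.
  split.
  - by have [? [? [_ []]]] := stepn.
  - exact: (sESAV2_MBP L0 k0 e0 stab htau0 ShQ stepn Qe gG cfl).
  - rewrite (le_trans E_le) // andbT.
    by have [? [? [_ [_ _ ->]]]] := stepn; exact: Eh_clip_ge.
move=> n; apply: bigmax_le => // x _.
by have [] := inv n.
Qed.
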